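(* For $n\ge 3$ put \[ \mathcal{N}_n=\Bigl\{(a,c)\in\mathcal{U}_n:\ c_k=\kappa(a_{k+1}-a_1)(a_k-a_n)\ (1\le k\le n-1)\text{ for some }\kappa\in\mathbb{C}^\times\Bigr\}. \] Then $\mathcal{N}_n\subset\mathcal{R}_{n,\{1,n\}}$, and $\mathcal{N}_n$ is a smooth irreducible locally closed subvariety of $\mathcal{U}_n$ isomorphic to an open subset of $\mathbb{C}^{n+1}$. In particular \[ \dim\mathcal{N}_n=n+1,\qquad \operatorname{codim}_{\mathcal{U}_n}\mathcal{N}_n=n-2=\kappa(n,2). \]
   Context: For $a_1,\ldots,a_n,c_1,\ldots,c_{n-1}\in\mathbb{C}$, the polynomial $P_n(\lambda,t)\in\mathbb{C}[\lambda,t]$ is defined by $P_0=1$, $P_1=\lambda+a_1$, $P_k=(\lambda+a_k)P_{k-1}-t\,c_{k-1}P_{k-2}$ for $2\le k\le n$. The principal stratum is $\mathcal{U}_n=\{(a,c)\in\mathbb{C}^{2n-1}: a_i\neq a_j\ (i\neq j),\ c_1\cdots c_{n-1}\neq 0\}$. For a non-empty proper subset $S\subset\{1,\ldots,n\}$, $\mathcal{R}_{n,S}$ is the set of points of $\mathcal{U}_n$ for which $P_n$ has a factor $F\in\mathbb{C}[\lambda,t]$, monic in $\lambda$, with $F(\lambda,0)=\prod_{i\in S}(\lambda+a_i)$. For $1\le d\le n-1$, $\kappa(n,d)=\lceil d(n-d)/2\rceil$ (this number is unrelated to the parameter $\kappa$). *)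

(* Defs.v *)
From HB Require Import structures.
From mathcomp Require Import all_boot all_order all_algebra.
From mathcomp Require Import boolp classical_sets reals topology.
From mathcomp Require Import complex.
From mathcomp.multinomials Require Import mpoly.

Set Implicit Arguments.
Unset Strict Implicit.
Unset Printing Implicit Defensive.

Import GRing.Theory.
Local Open Scope classical_set_scope.
Local Open Scope ring_scope.

(* The alias keeps the Zariski topology apart from the product topology that
   matrices inherit from a topology on their entries. *)
Definition affine (K : closedFieldType) (m : nat) : Type := 'rV[K]_m.

HB.instance Definition _ (K : closedFieldType) (m : nat) :=
  Choice.on (affine K m).

Section ZariskiTopology.
Variables (K : closedFieldType) (m : nat).
Implicit Types (p g h : {mpoly K[m]}) (X Y U : set (affine K m)) (x : affine K m).

Definition coord x (i : 'I_m) : K := (x : 'rV[K]_m) ord0 i.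

Definition peval p x : K := meval (coord x) p.

Definition zero_locus (S : set ({mpoly K[m]})) : set (affine K m) :=
  [set x | forall p, S p -> peval p x = 0].

Definition zariski_open U := exists S, U = ~` zero_locus S.

Lemma zariski_openT : zariski_open setT.
Proof.
exists [set (1 : {mpoly K[m]})]; rewrite -setC0; congr (~` _); apply/esym/seteqP; split=> // x.
by move/(_ _ erefl)/eqP; rewrite /peval meval1 oner_eq0.
Qed.

Lemma zariski_openI : setI_closed zariski_open.
Proof.
move=> _ _ [S ->] [T ->]; 
exists [set p | exists2 g, S g & exists2 h, T h & p = g * h].
rewrite -setCU; congr (~` _); apply/seteqP; split=> x.
  move=> [Sx|Tx] _ [g Sg [h Th ->]]; rewrite /peval mevalM.
    by rewrite [X in X * _](Sx _ Sg) mul0r.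
  by rewrite [X in _ * X](Tx _ Th) mulr0.
move=> STx; apply: contrapT => /not_orP[/existsNP[g /not_implyP[Sg /eqP gx]]].
move=> /existsNP[h /not_implyP[Th /eqP hx]].
have /eqP := STx (g * h) (ex_intro2 _ _ g Sg (ex_intro2 _ _ h Th erefl)).
by rewrite /peval mevalM mulf_eq0 => /orP[]; apply/negP.
Qed.

Lemma zariski_open_bigcup (I : Type) (f : I -> set (affine K m)) :
  (forall i, zariski_open (f i)) -> zariski_open (\bigcup_i f i).
Proof.
move=> /choice[S fE]; exists (\bigcup_i S i).
apply/seteqP; split=> x.
  move=> [i _]; rewrite fE => nSx Sx; apply: nSx => p Sp.
  by apply: Sx; exists i.
move=> nSx; apply: contrapT => nfx; apply: nSx => p [i _ Sp].
apply: contrapT => px; apply: nfx; exists i => //.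
by rewrite fE => Sx; apply: px; apply: Sx.
Qed.

HB.instance Definition _ := isOpenTopological.Build (affine K m)
  zariski_openT zariski_openI zariski_open_bigcup.

Lemma affine_openE U : open U = zariski_open U.
Proof. by []. Qed.

Lemma affine_closedP X : closed X <-> exists S, X = zero_locus S.
Proof.
rewrite -openC affine_openE; split=> -[S XE]; exists S; last by rewrite XE.
exact: setC_inj.
Qed.

End ZariskiTopology.

Section TopologicalNotions.
Variable T : topologicalType.
Implicit Types (X Y Z U : set T) (Zs : nat -> set T) (x : T) (d l : nat).

Definition closed_in X Z := exists2 F, closed F & Z = X `&` F.

Definition locally_closed_in X Z :=
  exists O F, [/\ open O, closed F & Z = X `&` (O `&` F)].

Definition irreducible X := X !=set0 /\
  forall F G, closed F -> closed G -> X `<=` F `|` G -> X `<=` F \/ X `<=` G.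

(* Zs 0 < ... < Zs l ; the values of Zs beyond l are irrelevant. *)
Definition irreducible_chain X Zs l :=
  (forall i, (i <= l)%N -> closed_in X (Zs i) /\ irreducible (Zs i)) /\
  (forall i, (i < l)%N -> Zs i `<` Zs i.+1).

Definition max_length (chain : (nat -> set T) -> nat -> Prop) d :=
  (exists Zs, chain Zs d) /\ (forall Zs l, chain Zs l -> (l <= d)%N).

Definition has_dim X d := max_length (irreducible_chain X) d.

Definition has_dim_at X x d :=
  max_length (fun Zs l =>
    irreducible_chain X Zs l /\ forall i, (i <= l)%N -> Zs i x) d.

(* codimension in X of the closure in X of the irreducible subset Y *)
Definition has_codim X Y d :=
  max_length (fun Zs l =>
    irreducible_chain X Zs l /\ Zs 0%N = X `&` closure Y) d.

End TopologicalNotions.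

Section QuasiAffineVarieties.
Variable K : closedFieldType.

Definition regular m (X : set (affine K m)) (f : affine K m -> K) :=
  forall x, X x -> exists (O : set (affine K m)) (g h : {mpoly K[m]}),
    [/\ open O, O x &
        forall y, X y -> O y -> peval h y != 0 /\ f y = peval g y / peval h y].

Definition morphism m k (X : set (affine K m)) (Y : set (affine K k))
    (f : affine K m -> affine K k) :=
  (forall x, X x -> Y (f x)) /\ forall i, regular X (fun x => coord (f x) i).

Definition isomorphic m k (X : set (affine K m)) (Y : set (affine K k)) :=
  exists f g, [/\ morphism X Y f, morphism Y X g,
    forall x, X x -> g (f x) = x & forall y, Y y -> f (g y) = y].

(* Zariski tangent space; the polynomials vanishing on X are those vanishing
   on its closure, so this applies to locally closed X. *)
Definition is_tangent_space m (X : set (affine K m)) (x : affine K m)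
    (V : {vspace 'rV[K]_m}) :=
  forall v : 'rV[K]_m, v \in V <->
    forall p : {mpoly K[m]}, (forall y, X y -> peval p y = 0) ->
      \sum_(i < m) peval (mderiv i p) x * v ord0 i = 0.

Definition smooth m (X : set (affine K m)) :=
  forall x, X x -> exists (V : {vspace 'rV[K]_m}) (d : nat),
    [/\ is_tangent_space X x V, has_dim_at X x d & \dim V = d].

End QuasiAffineVarieties.

Section Strata.
Variables (K : closedFieldType) (n : nat).
Implicit Types x : affine K (n + n.-1).

(* A point is the row (a_1, ..., a_n, c_1, ..., c_(n-1)). The accessors below
   are indexed from 1 ; outside 1 <= k <= n (resp. 1 <= k <= n - 1) their
   values are meaningless and never used. *)
Definition a_ x (k : nat) : K :=
  oapp (fun i : 'I_n => coord x (lshift n.-1 i)) 0 (insub k.-1).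

Definition c_ x (k : nat) : K :=
  oapp (fun i : 'I_n.-1 => coord x (rshift n i)) 0 (insub k.-1).

Lemma a_E x (i : 'I_n) : a_ x i.+1 = coord x (lshift n.-1 i).
Proof. by rewrite /a_ /= valK. Qed.

Lemma c_E x (i : 'I_n.-1) : c_ x i.+1 = coord x (rshift n i).
Proof. by rewrite /c_ /= valK. Qed.

(* C[lambda, t] is encoded as C[t][lambda]. *)
Local Notation lambda := ('X : {poly {poly K}}).
Local Notation t := (('X : {poly K})%:P : {poly {poly K}}).
Local Notation cst z := ((z%:P : {poly K})%:P : {poly {poly K}}).

Fixpoint P_ x (k : nat) : {poly {poly K}} :=
  match k with
  | 0 => 1
  | 1 => lambda + cst (a_ x 1)
  | (k'.+1 as k1).+1 =>
      (lambda + cst (a_ x k1.+1)) * P_ x k1 - t * cst (c_ x k1) * P_ x k'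
  end.

Definition principal_stratum : set (affine K (n + n.-1)) :=
  [set x | (forall i j, (1 <= i <= n)%N -> (1 <= j <= n)%N -> i <> j ->
              a_ x i <> a_ x j) /\
           \prod_(1 <= k < n) c_ x k != 0].

Definition at_t0 (F : {poly {poly K}}) : {poly K} :=
  map_poly (horner_eval 0) F.

(* The ordinal i stands for the index i + 1. *)
Definition reducible_stratum (S : {set 'I_n}) : set (affine K (n + n.-1)) :=
  [set x | principal_stratum x /\
     exists F : {poly {poly K}},
       [/\ exists G, P_ x n = F * G, F \is monic &
           at_t0 F = \prod_(i in S) ('X + (a_ x i.+1)%:P)]].

Definition first_last : {set 'I_n} :=
  [set i : 'I_n | (i.+1 == 1)%N || (i.+1 == n)%N]%SET.

Definition N_ : set (affine K (n + n.-1)) :=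
  [set x | principal_stratum x /\
     exists2 kappa : K, kappa != 0 &
       forall k, (1 <= k <= n.-1)%N ->
         c_ x k = kappa * (a_ x k.+1 - a_ x 1) * (a_ x k - a_ x n)].

End Strata.

Definition kappa_codim (n d : nat) : nat := uphalf (d * (n - d)).

(* Main.v *)
From HB Require Import structures.
From mathcomp Require Import all_boot all_order all_algebra.
From mathcomp Require Import boolp classical_sets reals topology complex.
From mathcomp.multinomials Require Import mpoly.
From mathcomp Require Import ring zify.
Require Import Defs.

Set Implicit Arguments.
Unset Strict Implicit.
Unset Printing Implicit Defensive.

Import GRing.Theory.
Local Open Scope classical_set_scope.

(** Over an algebraically closed field write
    gap_k(a) = (a_(k+1) - a_1) (a_k - a_n), so that N is the set of points of the
    principal stratum U with c_k = kappa gap_k(a) for all k and some kappa <> 0.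

    Reducibility. Put u = lambda + a_1, w = lambda + a_n, tau = kappa t and
    F = u w + tau (u - w)^2, a polynomial of degree 2 in lambda. With
    Q_k = P_k - tau (a_k - a_n) P_(k-1), both u P_k - (u - w) Q_k and
    w Q_k + (u - w) tau P_k are multiples of F, by a simultaneous induction on k;
    the first of them, for k = n - 1, is P_n ([quadratic_factor_dvd]).

    Dimension. Two facts suffice.
    - A chain of irreducible subsets of affine m-space, each not contained in the
      closure of the previous one, has length at most m ([chain_length_le]). If g
      vanishes on Z but not on the irreducible Z', and (h_j) is linearly
      independent on Z, then the products h_j g^e are linearly independent on Z'.
      A chain of length l thus produces, for each B, a set of B^l polynomials of
      degree O(B) which are linearly independent, and these live in a space of
      dimension O(B^m).
    - Through every point of N there passes a chain of length 2n - 1 of closed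
      irreducible subsets of U having N as its term of index n + 1
      ([flag], [flag_separated]).
    Gluing an arbitrary chain in N to the upper part of this flag, or an arbitrary
    chain above N to its lower part, bounds both lengths by the dimension 2n - 1
    of the ambient space; the two parts of the flag attain the bounds.

    Irreducibility never uses more than polynomials in one variable: a set in which
    any two points are joined by a polynomial curve that stays in the set for
    almost all parameters is irreducible ([irreducible_curves]).

    Smoothness. The differential of (a, kappa) |-> (a, kappa gap(a)) is injective
    on a space of dimension n + 1. Its image is tangent to N because polynomials
    vanishing on N can be differentiated along curves in N, and it is cut out by
    the differentials of the equations c_k gap_1 = c_1 gap_k.

    Finally (a, c) |-> (a, c_1 / gap_1(a)) is an isomorphism of N onto the open set
    of the (a, kappa) whose image (a, kappa gap(a)) lies in U. *)

(** * Polynomial functions and polynomial curves *)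

Section PolynomialCurves.
Local Open Scope ring_scope.
Variables (K : closedFieldType) (m : nat).
Implicit Types (p q : {mpoly K[m]}) (g : 'I_m -> {poly K}) (x : affine K m).

(** Polynomials are generated by the constants and the variables. *)
Lemma mpoly_alg_ind (P : {mpoly K[m]} -> Prop) :
  (forall c, P c%:MP) -> (forall i, P 'X_i) ->
  (forall p q, P p -> P q -> P (p + q)) ->
  (forall p q, P p -> P q -> P (p * q)) -> forall p, P p.
Proof.
move=> PC PX PD PM p; elim/mpolyind: p => [|c u p _ _ Pp].
  by rewrite -(mpolyC0 m K).
apply: PD => //; rewrite -mul_mpolyC; apply: (PM _ _ (PC _)).
rewrite mpolyXE_id; elim/big_ind: _ => [|a b|i _]; [|exact: PM|].
  by rewrite -(mpolyC1 m K).
elim: (u i) => [|k IH]; first by rewrite expr0 -(mpolyC1 m K).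
by rewrite exprS; apply: PM.
Qed.

Lemma pevalC c x : peval c%:MP x = c. Proof. exact: mevalC. Qed.
Lemma pevalU i x : peval 'X_i x = coord x i. Proof. exact: mevalXU. Qed.
Lemma pevalD p q x : peval (p + q) x = peval p x + peval q x.
Proof. exact: mevalD. Qed.
Lemma pevalB p q x : peval (p - q) x = peval p x - peval q x.
Proof. exact: mevalB. Qed.
Lemma pevalM p q x : peval (p * q) x = peval p x * peval q x.
Proof. exact: mevalM. Qed.
Lemma pevalZ c p x : peval (c *: p) x = c * peval p x.
Proof. exact: mevalZ. Qed.
Lemma peval_exp p e x : peval (p ^+ e) x = peval p x ^+ e.
Proof. exact: rmorphXn. Qed.
Lemma peval_sum (I : Type) (r : seq I) (P : pred I) (f : I -> {mpoly K[m]}) x :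
  peval (\sum_(i <- r | P i) f i) x = \sum_(i <- r | P i) peval (f i) x.
Proof. exact: rmorph_sum. Qed.
Lemma peval_prod (I : Type) (r : seq I) (P : pred I) (f : I -> {mpoly K[m]}) x :
  peval (\prod_(i <- r | P i) f i) x = \prod_(i <- r | P i) peval (f i) x.
Proof. exact: rmorph_prod. Qed.

Definition pevalE := (pevalC, pevalU, pevalB, pevalD, pevalM, pevalZ, peval_exp,
  peval_sum, peval_prod).

(** The point with parameter [t] on the curve whose coordinates are the univariate
    polynomials [g i]. *)
Definition curve_at g (t : K) : affine K m := \row_i (g i).[t].

(** The univariate polynomial [p(g_1, ..., g_m)]: the restriction of [p] to the
    curve [g]. *)
Definition pullback g p : {poly K} := mmap polyC g p.

HB.instance Definition _ g :=
  GRing.RMorphism.copy (pullback g) (mmap polyC g).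

Lemma pullbackC g c : pullback g c%:MP = c%:P.
Proof. by rewrite /pullback mmapC. Qed.

Lemma pullbackX g i : pullback g 'X_i = g i.
Proof. by rewrite /pullback mmapX mmap1U. Qed.

Lemma coord_row (f : 'I_m -> K) i : coord (\row_j f j : affine K m) i = f i.
Proof. by rewrite /coord mxE. Qed.

Lemma horner_pullback g p t : (pullback g p).[t] = peval p (curve_at g t).
Proof.
elim/mpoly_alg_ind: p => [c|i|p q IHp IHq|p q IHp IHq].
- by rewrite pullbackC pevalC hornerC.
- by rewrite pullbackX pevalU coord_row.
- by rewrite rmorphD pevalD hornerD IHp IHq.
by rewrite rmorphM pevalM hornerM IHp IHq.
Qed.

(** The chain rule. *)
Lemma deriv_pullback g p :
  (pullback g p)^`() = \sum_(i < m) pullback g p^`M(i) * (g i)^`().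
Proof.
elim/mpoly_alg_ind: p => [c|j|p q IHp IHq|p q IHp IHq].
- rewrite pullbackC derivC big1 // => i _.
  by rewrite mderivC rmorph0 mul0r.
- rewrite pullbackX (bigD1 j) //= big1 => [|i ij].
    have -> : 'X_j^`M(j) = 1 :> {mpoly K[m]}.
      by rewrite mderivX mnm1E eqxx scale1r -[X in (X - _)%MM]add0m addmK mpolyX0.
    by rewrite addr0 rmorph1 mul1r.
  by rewrite mderivX mnm1E eq_sym (negbTE ij) scale0r rmorph0 mul0r.
- rewrite rmorphD derivD IHp IHq -big_split; apply: eq_bigr => i _ /=.
  by rewrite mderivD rmorphD mulrDl.
rewrite rmorphM derivM IHp IHq mulr_suml mulr_sumr -big_split.
by apply: eq_bigr => i _ /=; rewrite mderivM rmorphD !rmorphM; ring.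
Qed.

(** The derivative of [p] at [x] in the direction [v]. *)
Definition dir_deriv p x (v : 'rV[K]_m) : K :=
  \sum_(i < m) peval (mderiv i p) x * v ord0 i.

Lemma dir_deriv_curve g p t (v : 'rV[K]_m) :
  (forall i, ((g i)^`()).[t] = v ord0 i) ->
  dir_deriv p (curve_at g t) v = ((pullback g p)^`()).[t].
Proof.
move=> gv; rewrite deriv_pullback horner_sum; apply: eq_bigr => i _.
by rewrite hornerM horner_pullback gv.
Qed.

Lemma closed_zero p : closed [set x | peval p x = 0].
Proof.
apply/affine_closedP; exists [set p]; apply/seteqP; split=> x /=.
  by move=> px q ->.
exact.
Qed.

Lemma open_nonzero p : open [set x | peval p x != 0].
Proof.
rewrite (_ : [set _ | _] = ~` [set x | peval p x = 0]).
  by apply: closed_openC; exact: closed_zero.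
by apply/seteqP; split=> x /= /eqP.
Qed.

Lemma closed_separate (F : set (affine K m)) x : closed F -> ~ F x ->
  exists2 p, forall y, F y -> peval p y = 0 & peval p x != 0.
Proof.
move=> /affine_closedP[S ->] /existsNP[p /not_implyP[Sp /eqP px]].
by exists p => // y; apply.
Qed.

(** If [F] and [G] are closed, [x] is not in [F] and [y] is not in [G], then only
    finitely many parameters of a curve from [x] to [y] give points of [F `|` G].
    Membership in [X] is only required outside the roots of [h]. *)
Lemma irreducible_curves (X : set (affine K m)) : X !=set0 ->
  (forall x y, X x -> X y -> exists g h,
     [/\ curve_at g 0 = x, curve_at g 1 = y, h != 0 &
         forall t, h.[t] != 0 -> X (curve_at g t)]) ->
  irreducible X.
Proof.
move=> X0 conn; split=> // F G Fc Gc XFG.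
apply: contrapT => /not_orP[/existsNP[x /not_implyP[Xx Fx]]].
move=> /existsNP[y /not_implyP[Xy Gy]].
have [p Fp px] := closed_separate Fc Fx.
have [q Gq qy] := closed_separate Gc Gy.
have [g [h [gx gy h0 gX]]] := conn x y Xx Xy.
have p0 : pullback g p != 0.
  by apply: contraNneq px => p0; rewrite -gx -horner_pullback p0 horner0.
have q0 : pullback g q != 0.
  by apply: contraNneq qy => q0; rewrite -gy -horner_pullback q0 horner0.
have /closed_nonrootP[t] : h * (pullback g p * pullback g q) != 0.
  by rewrite !mulf_neq0.
rewrite rootE !hornerM !mulf_eq0 !horner_pullback !negb_or.
move=> /and3P[ht pt qt]; case: (XFG _ (gX t ht)) => [/Fp|/Gq] /eqP.
  by rewrite (negbTE pt).
by rewrite (negbTE qt).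
Qed.

End PolynomialCurves.

(** * Length of chains of irreducible sets *)

Section DimensionBound.
Local Open Scope ring_scope.
Variables (K : closedFieldType) (m : nat).
Implicit Types (p q : {mpoly K[m]}) (x : affine K m) (Z : set (affine K m)).

Lemma irreducible_mul0 Z p q : irreducible Z ->
  (forall y, Z y -> peval p y * peval q y = 0) ->
  (forall y, Z y -> peval p y = 0) \/ (forall y, Z y -> peval q y = 0).
Proof.
move=> [_ irrZ] pq0.
apply: (irrZ [set y | peval p y = 0] [set y | peval q y = 0]);
  [exact: closed_zero | exact: closed_zero |].
by move=> y /pq0/eqP; rewrite mulf_eq0 => /orP[]/eqP; [left|right].
Qed.

Lemma irreducible_exp Z g q e : irreducible Z ->
  ~ (forall y, Z y -> peval g y = 0) ->
  (forall y, Z y -> peval g y ^+ e * peval q y = 0) ->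
  forall y, Z y -> peval q y = 0.
Proof.
move=> irrZ gZ; elim: e => [|e IH] gq; first by move=> y /gq; rewrite mul1r.
apply: IH; have [//|//|] := @irreducible_mul0 Z g (g ^+ e * q) irrZ.
  by move=> y /gq; rewrite !pevalE exprS mulrA.
by move=> h y /h; rewrite !pevalE.
Qed.

(** The polynomials [h j] are linearly independent as functions on [Z]. *)
Definition lin_indep_on (J : finType) (h : J -> {mpoly K[m]}) Z :=
  forall a : J -> K, (forall y, Z y -> \sum_j a j * peval (h j) y = 0) ->
  forall j, a j = 0.

(** In a relation on [Z'], the lowest power of [g] that occurs can be cancelled,
    [Z'] being irreducible; restricting to [Z] then kills its coefficients. *)
Lemma lin_indep_powers (J : finType) (h : J -> {mpoly K[m]}) Z
    (Z' : set (affine K m)) g N :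
  Z `<=` Z' -> irreducible Z' -> (forall y, Z y -> peval g y = 0) ->
  ~ (forall y, Z' y -> peval g y = 0) -> lin_indep_on h Z ->
  lin_indep_on (fun u : J * 'I_N => h u.1 * g ^+ u.2) Z'.
Proof.
move=> ZZ' irrZ' gZ gZ' hZ a a0.
suff H e : forall j (k : 'I_N), (k <= e)%N -> a (j, k) = 0.
  by case=> j k; apply: (H k).
elim/ltn_ind: e => e IH j k; rewrite leq_eqVlt => /orP[/eqP ke|ke]; last first.
  by apply: (IH _ ke j k).
(* b is the coefficient of g^k; the terms of higher order give g^(k+1) r *)
pose b : {mpoly K[m]} := \sum_(i : J) a (i, k) *: h i.
pose r : {mpoly K[m]} := \sum_(l : 'I_N | (k < l)%N) \sum_(i : J)
  a (i, l) *: (h i * g ^+ (l - k.+1)).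
have split_sum y : Z' y -> peval g y ^+ k * peval (b + g * r) y = 0.
  move=> Z'y; rewrite -[RHS](a0 y Z'y) /=.
  transitivity (\sum_i \sum_l a (i, l) * peval (h i * g ^+ l) y); last first.
    by rewrite pair_bigA; apply: eq_bigr => -[].
  rewrite exchange_big /= (bigID (fun l : 'I_N => (k < l)%N)) /= addrC.
  rewrite [X in _ = X + _](bigD1 k) ?ltnn //= [X in _ = _ + X + _]big1 ?addr0.
    rewrite !pevalE mulrDr; congr (_ + _).
      by rewrite mulr_sumr; apply: eq_bigr => i _; rewrite !pevalE; ring.
    rewrite !mulr_sumr; apply: eq_bigr => l kl.
    rewrite pevalE !mulr_sumr; apply: eq_bigr => i _.
    rewrite !pevalE.
    by rewrite -[X in _ = _ * (_ * _ ^+ X)](subnKC kl) exprD exprS; ring.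
  move=> l; rewrite -leqNgt => /andP[lk lNk]; apply: big1 => i _.
  suff -> : a (i, l) = 0 by rewrite mul0r.
  apply: (IH l) => //; rewrite -ke ltn_neqAle lk andbT.
  by apply: contra lNk => /eqP/val_inj->.
have br0 := irreducible_exp irrZ' gZ' split_sum.
apply: (hZ (fun i => a (i, k))) => y Zy.
have := br0 y (ZZ' _ Zy); rewrite pevalD pevalM gZ // mul0r addr0 pevalE => {2}<-.
by apply: eq_bigr => i _; rewrite pevalZ.
Qed.

(** [Z] is contained in the irreducible set [Z'], whereas [Z'] is not contained
    in the closure of [Z]. *)
Definition separated Z (Z' : set (affine K m)) :=
  [/\ Z `<=` Z', irreducible Z' & exists2 F, closed F & Z `<=` F /\ ~ (Z' `<=` F)].

Lemma msize_mul_exp p g e :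
  (msize (p * g ^+ e) <= msize p + e * msize g)%N.
Proof.
elim: e => [|e IH]; first by rewrite expr0 mulr1 addn0.
have [->|g0] := eqVneq g 0; first by rewrite exprS mul0r mulr0 msize0.
have [->|p0] := eqVneq p 0; first by rewrite mul0r msize0.
rewrite exprSr mulrA msizeM ?mulf_neq0 ?expf_neq0 //.
rewrite mulSn addnCA; have : (0 < msize g)%N by rewrite lt0n msize_poly_eq0.
by case: (msize g) IH => // s IH _; rewrite addnS /= addnC addSn ltnW // ltnS leq_add2l.
Qed.

(** The constant [D] depends on the chain only; [N] bounds the exponents. *)
Lemma chain_family (Zs : nat -> set (affine K m)) l : Zs 0%N !=set0 ->
  (forall i, (i < l)%N -> separated (Zs i) (Zs i.+1)) ->
  exists D, forall N, exists (J : finType) (h : J -> {mpoly K[m]}),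
    [/\ #|J| = (N ^ l)%N, lin_indep_on h (Zs l) &
        forall j, (msize (h j) <= (N * D).+1)%N].
Proof.
move=> Z0; elim: l => [|l IH] sepZ.
  exists 0%N => N; exists unit, (fun=> 1); split; first by rewrite card_unit.
    move=> a a0 []; case: Z0 => y /a0.
    by rewrite (big_pred1 tt) => [|[]//]; rewrite /peval meval1 mulr1.
  by move=> _; rewrite msize1.
have [|D IHD] := IH; first by move=> i il; apply/sepZ/ltnW.
have [ZZ' irrZ' [F Fc [ZF ZF']]] := sepZ l (ltnSn l).
move: ZF' => /existsNP[y /not_implyP[Zy Fy]].
have [g gF gy] := closed_separate Fc Fy.
exists (D + msize g)%N => N; have [J [h [cJ hZ hD]]] := IHD N.
exists (J * 'I_N)%type, (fun u : J * 'I_N => h u.1 * g ^+ u.2); split.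
- by rewrite card_prod cJ card_ord expnSr.
- apply: lin_indep_powers ZZ' irrZ' _ _ hZ => [z /ZF/gF //|].
  by move=> /(_ y Zy)/eqP; apply/negP.
move=> [j k] /=; apply: leq_trans (msize_mul_exp _ _ _) _.
by rewrite mulnDr -addSn leq_add // leq_mul2r ltnW ?orbT.
Qed.

(** There are at most [M ^ m] monomials of degree less than [M]. *)
Lemma lin_indep_card (J : finType) (h : J -> {mpoly K[m]}) Z M :
  lin_indep_on h Z -> (forall j, (msize (h j) <= M)%N) -> (#|J| <= M ^ m)%N.
Proof.
move=> hZ hM; rewrite leqNgt; apply/negP => JM.
pose T := {ffun 'I_m -> 'I_M}.
have cT : #|T| = (M ^ m)%N by rewrite card_ffun !card_ord.
pose mon (f : T) := [multinom (f s : nat) | s < m].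
(* the coefficients of the h_j; more rows than columns force a relation *)
pose A : 'M[K]_(#|J|, #|T|) :=
  \matrix_(i, j) (h (enum_val i))@_(mon (enum_val j)).
have /rowV0Pn[v /sub_kermxP vA /negP v0] : kermx A != 0.
  rewrite kermx_eq0 /row_free neq_ltn.
  by rewrite (leq_ltn_trans (rank_leq_col A)) // cT.
apply: v0; apply/eqP/rowP => i; rewrite mxE.
pose a j := v ord0 (enum_rank j).
have -> : v ord0 i = a (enum_val i) by rewrite /a enum_valK.
apply: hZ => y _.
suff -> : \sum_j a j * peval (h j) y = peval (\sum_j a j *: h j) y.
  suff -> : \sum_j a j *: h j = 0 by rewrite /peval meval0.
  apply/mpolyP => u; rewrite mcoeff0 linear_sum /=.
  have [uM|/forallPn[s uM]] := boolP [forall s, (u s < M)%N].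
    pose f : T := [ffun s => Ordinal (forallP uM s)].
    transitivity ((v *m A) ord0 (enum_rank f)); last by rewrite vA mxE.
    rewrite mxE (reindex (@enum_rank J)) /=; last exact/onW_bij/enum_rank_bij.
    apply: eq_bigr => j _.
    rewrite mcoeffZ mxE !enum_rankK; congr (_ * _@__).
    by apply/mnmP => s; rewrite mnmE ffunE.
  apply: big1 => j _; rewrite mcoeffZ.
  rewrite (_ : (h j)@_u = 0) ?mulr0 //; apply: memN_msupp_eq0.
  apply: msize_mdeg_ge; apply: leq_trans (hM j) _.
  move: uM; rewrite -leqNgt => /leq_trans; apply.
  by rewrite mdegE (bigD1 s) //= leq_addr.
by rewrite pevalE; apply: eq_bigr => j _; rewrite pevalZ.
Qed.

Theorem chain_length_le (Zs : nat -> set (affine K m)) l : Zs 0%N !=set0 ->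
  (forall i, (i < l)%N -> separated (Zs i) (Zs i.+1)) -> (l <= m)%N.
Proof.
move=> Z0 sepZ; rewrite leqNgt; apply/negP => ml.
have [D HD] := chain_family Z0 sepZ.
(* for this N one has (N D + 1)^m <= N^m (D + 1)^m < N^(m + 1) <= N^l *)
pose N := (D.+1 ^ m).+1.
have [J [h [cJ hZ hD]]] := HD N.
have := lin_indep_card hZ hD; rewrite cJ; apply/negP; rewrite -ltnNge.
have ND : ((N * D).+1 <= N * D.+1)%N by rewrite mulnS addnC -addn1 leq_add2l.
apply: (@leq_ltn_trans ((N * D.+1) ^ m)); first by case: (m) => // m'; rewrite leq_exp2r.
rewrite expnMn; apply: (@leq_trans (N ^ m.+1)).
  by rewrite expnSr ltn_pmul2l ?expn_gt0 // ltnSn.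
by rewrite leq_exp2l // ltnS expn_gt0.
Qed.

End DimensionBound.

(** * Coordinates on the principal stratum *)

Section Coordinates.
Local Open Scope ring_scope.
Variables (K : closedFieldType) (n : nat).
Implicit Types (x y : affine K (n + n.-1)).

(** The coordinate functions [a_k] and [c_k] as polynomials; like the accessors,
    they are indexed from 1. *)
Definition mA (k : nat) : {mpoly K[n + n.-1]} :=
  oapp (fun i : 'I_n => 'X_(lshift n.-1 i)) 0 (insub k.-1).

Definition mC (k : nat) : {mpoly K[n + n.-1]} :=
  oapp (fun i : 'I_n.-1 => 'X_(rshift n i)) 0 (insub k.-1).

Lemma peval_mA k x : peval (mA k) x = a_ x k.
Proof.
rewrite /mA /a_; case: insub => [i|] /=; first by rewrite pevalU.
by rewrite /peval meval0.
Qed.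

Lemma peval_mC k x : peval (mC k) x = c_ x k.
Proof.
rewrite /mC /c_; case: insub => [i|] /=; first by rewrite pevalU.
by rewrite /peval meval0.
Qed.

(** The family indexed by the coordinates with entries [a 1, ..., a n],
    [c 1, ..., c (n - 1)]. *)
Definition glue (T : Type) (a c : nat -> T) (i : 'I_(n + n.-1)) : T :=
  match split i with inl j => a j.+1 | inr j => c j.+1 end.

Lemma glue_l T (a c : nat -> T) i : glue a c (lshift _ i) = a i.+1.
Proof. by rewrite /glue (unsplitK (inl i)). Qed.

Lemma glue_r T (a c : nat -> T) i : glue a c (rshift _ i) = c i.+1.
Proof. by rewrite /glue (unsplitK (inr i)). Qed.

Definition point (a c : nat -> K) : affine K (n + n.-1) := \row_i glue a c i.

Lemma a_ord x k (kn : (0 < k <= n)%N) :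
  exists2 i : 'I_n, k = i.+1 & a_ x k = coord x (lshift n.-1 i).
Proof.
case: k kn => // k /= kn; exists (Ordinal kn) => //.
by rewrite -[k in a_ x k.+1]/(nat_of_ord (Ordinal kn)) a_E.
Qed.

Lemma c_ord x k (kn : (0 < k <= n.-1)%N) :
  exists2 i : 'I_n.-1, k = i.+1 & c_ x k = coord x (rshift n i).
Proof.
case: k kn => // k /= kn; exists (Ordinal kn) => //.
by rewrite -[k in c_ x k.+1]/(nat_of_ord (Ordinal kn)) c_E.
Qed.

Lemma a_point a c k : (0 < k <= n)%N -> a_ (point a c) k = a k.
Proof. by move=> /(a_ord (point a c))[i -> ->]; rewrite coord_row glue_l. Qed.

Lemma c_point a c k : (0 < k <= n.-1)%N -> c_ (point a c) k = c k.
Proof. by move=> /(c_ord (point a c))[i -> ->]; rewrite coord_row glue_r. Qed.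

Lemma affine_ext x y : (forall k, (0 < k <= n)%N -> a_ x k = a_ y k) ->
  (forall k, (0 < k <= n.-1)%N -> c_ x k = c_ y k) -> x = y.
Proof.
move=> axy cxy; apply/rowP => i; rewrite -[LHS]/(coord x i) -[RHS]/(coord y i).
rewrite -(splitK i); case: (split i) => j /=.
  by rewrite -!a_E axy //= ltn_ord.
by rewrite -!c_E cxy //= ltn_ord.
Qed.

Lemma curve_glue (a c : nat -> {poly K}) t :
  curve_at (glue a c) t = point (fun k => (a k).[t]) (fun k => (c k).[t]).
Proof.
apply/rowP => i; rewrite !mxE /glue; by case: (split i).
Qed.

(** The polynomial whose non-vanishing defines the principal stratum. *)
Definition discr : {mpoly K[n + n.-1]} :=
  (\prod_(u : 'I_n * 'I_n | u.1 != u.2) (mA u.1.+1 - mA u.2.+1)) *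
  \prod_(1 <= k < n) mC k.

Lemma principal_stratumE x : principal_stratum x <-> peval discr x != 0.
Proof.
have cE : peval (\prod_(1 <= k < n) mC k) x = \prod_(1 <= k < n) c_ x k.
  by rewrite peval_prod; apply: eq_bigr => k _; rewrite peval_mC.
rewrite /discr pevalM cE peval_prod mulf_eq0 negb_or.
split=> [[ax cx]|/andP[/prodf_neq0 ax cx]].
  apply/andP; split; last exact: cx.
  apply/prodf_neq0 => -[i j] /= ij.
  rewrite pevalB !peval_mA subr_eq0; apply/eqP/ax => //= -[/val_inj/eqP].
  by rewrite (negbTE ij).
split; last exact: cx.
move=> i j /(a_ord x)[i' -> _] /(a_ord x)[j' -> _] ij.
have := ax (i', j') => /=; rewrite pevalB !peval_mA subr_eq0 => aij.
by apply/eqP/aij; apply/eqP => ij'; apply: ij; rewrite ij'.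
Qed.

Lemma stratum_c x k : principal_stratum x -> (0 < k <= n.-1)%N -> c_ x k != 0.
Proof.
move=> [_]; rewrite big_nat prodf_seq_neq0 => /allP cx kn.
have /cx : k \in index_iota 1 n by rewrite mem_index_iota; lia.
by have -> : (0 < k < n)%N by lia.
Qed.

Lemma point_stratum a c :
  (forall i j, (0 < i <= n)%N -> (0 < j <= n)%N -> a i = a j -> i = j) ->
  (forall k, (0 < k <= n.-1)%N -> c k != 0) -> principal_stratum (point a c).
Proof.
move=> ainj c0; split=> [i j ni nj ij|].
  by rewrite !a_point //; move=> /ainj; apply: contra_not ij; apply.
rewrite big_nat prodf_seq_neq0; apply/allP => k _; apply/implyP => kn.
by rewrite c_point ?c0 //; lia.
Qed.

(** [N] is given by the proportionality of [c_k] and [gap x k]; on the principal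
    stratum no [gap x k] with [1 <= k <= n - 1] is zero. *)
Definition gap x k := (a_ x k.+1 - a_ x 1) * (a_ x k - a_ x n).

Lemma gap_neq0 x k : principal_stratum x -> (0 < k <= n.-1)%N -> gap x k != 0.
Proof.
move=> [ax _] kn; by rewrite /gap mulf_neq0 // subr_eq0; apply/eqP; apply: ax; lia.
Qed.

Lemma N_gapP x : N_ x <-> principal_stratum x /\
  exists2 kappa : K, kappa != 0 &
    forall k, (0 < k <= n.-1)%N -> c_ x k = kappa * gap x k.
Proof.
by split=> -[Ux [kappa k0 ck]]; split=> //; exists kappa => // k kn;
  rewrite ck // /gap mulrA.
Qed.

Definition mgap k := (mA k.+1 - mA 1) * (mA k - mA n).

Lemma peval_mgap k x : peval (mgap k) x = gap x k.
Proof. by rewrite /mgap /gap !pevalE !peval_mA. Qed.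

Definition strataE := (peval_mgap, peval_mA, peval_mC, pevalE).

End Coordinates.
Arguments glue n {T} a c i.
Arguments point {K} n a c.
Arguments mA {K n} k.
Arguments mC {K n} k.
Arguments mgap {K n} k.

(** * A full flag through a point of N *)

Lemma exists_notin (K : closedFieldType) (s : seq K) : exists z, z \notin s.
Proof.
have : (\prod_(z <- s) ('X - z%:P) != 0)%R.
  by rewrite monic_neq0 ?monic_prod_XsubC.
by move=> /closed_nonrootP[z]; rewrite root_prod_XsubC => zs; exists z.
Qed.

Section Interpolation.
Local Open Scope ring_scope.
Variable K : closedFieldType.

(** The affine function with value [u] at 0 and [v] at 1. *)
Definition lerp (u v : K) : {poly K} := u%:P + (v - u)%:P * 'X.

Lemma lerp0 u v : (lerp u v).[0] = u.
Proof. by rewrite /lerp hornerD hornerM !hornerC hornerX; ring. Qed.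

Lemma lerp1 u v : (lerp u v).[1] = v.
Proof. by rewrite /lerp hornerD hornerM !hornerC hornerX; ring. Qed.

Lemma lerp_id u t : (lerp u u).[t] = u.
Proof. by rewrite /lerp hornerD hornerM !hornerC hornerX; ring. Qed.

End Interpolation.

Section Flag.
Local Open Scope ring_scope.
Variables (K : closedFieldType) (n : nat).
Hypothesis n_ge3 : (3 <= n)%N.
Implicit Types (x y : affine K (n + n.-1)) (s : nat).
Local Notation U := (@principal_stratum K n).

(** The term of index [s] of the flag through [x0]. Up to index [n], [kappa] is
    fixed and the last [n - s] of the [a_i] are those of [x0]; at [n + 1] also
    [kappa] is free, which gives [N]; beyond it, the conditions on the [c_k] are
    dropped one by one, starting with [k = n - 1]. The condition with [k = 1], which
    merely defines [kappa], still stands at [s = 2n - 1], where the term is the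
    whole principal stratum. *)
Definition flag x0 (kappa0 : K) s : set (affine K (n + n.-1)) :=
  [set x | U x /\ exists kappa, [/\ kappa != 0, (s <= n)%N -> kappa = kappa0,
     forall k, (0 < k <= n.-1)%N -> (k + s <= n.*2)%N -> c_ x k = kappa * gap x k &
     forall i, (s < i <= n)%N -> a_ x i = a_ x0 i]].

(** Equations of [flag x0 kappa0 s] inside the principal stratum. *)
Definition flag_eqs x0 (kappa0 : K) s : set {mpoly K[n + n.-1]} :=
  [set p | [\/ exists k, [/\ (0 < k <= n.-1)%N, (k + s <= n.*2)%N &
                  p = mC k * mgap 1 - mC 1 * mgap k],
               (s <= n)%N /\ p = mC 1 - kappa0 *: mgap 1 |
               exists2 i, (s < i <= n)%N & p = mA i - (a_ x0 i)%:MP]].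

Lemma flag_closed x0 kappa0 s : kappa0 != 0 ->
  flag x0 kappa0 s = U `&` zero_locus (flag_eqs x0 kappa0 s).
Proof.
move=> k0; have n1 : (0 < 1 <= n.-1)%N by lia.
apply/seteqP; split=> x [Ux].
  move=> [kappa [kappa_n0 kappaE cE aE]]; split=> // p [].
  - move=> [k [kn ks ->]]; rewrite !strataE cE // cE //; last lia.
    by ring.
  - by move=> [sn ->]; rewrite !strataE cE ?kappaE ?subrr //; lia.
  by move=> [i si ->]; rewrite !strataE aE ?subrr.
move=> eqs; split=> //; have g1 := gap_neq0 Ux n1.
exists (c_ x 1 / gap x 1); split.
- by rewrite mulf_neq0 ?invr_eq0 ?stratum_c.
- move=> sn; have /eqs/eqP : flag_eqs x0 kappa0 s (mC 1 - kappa0 *: mgap 1).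
    by apply: Or32.
  by rewrite !strataE subr_eq0 => /eqP->; rewrite mulfK.
- move=> k kn ks; have /eqs/eqP : flag_eqs x0 kappa0 s
    (mC k * mgap 1 - mC 1 * mgap k) by apply: Or31; exists k.
  rewrite !strataE subr_eq0 => /eqP ck.
  by apply: (mulIf g1); rewrite ck mulrAC mulfVK.
move=> i si; have /eqs/eqP : flag_eqs x0 kappa0 s (mA i - (a_ x0 i)%:MP).
  by apply: Or33; exists i.
by rewrite !strataE subr_eq0 => /eqP.
Qed.

Lemma zero_locus_closed m (S : set {mpoly K[m]}) : closed (zero_locus S).
Proof. by apply/affine_closedP; exists S. Qed.

Lemma flag_sub x0 kappa0 s s' : (s <= s')%N ->
  flag x0 kappa0 s `<=` flag x0 kappa0 s'.
Proof.
move=> ss' x [Ux [kappa [k0 kE cE aE]]]; split=> //; exists kappa; split=> //.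
- by move=> s'n; apply/kE/(leq_trans ss').
- by move=> k kn ks; apply: cE => //; lia.
by move=> i si; apply: aE; lia.
Qed.

Lemma flag_N x0 kappa0 : flag x0 kappa0 n.+1 = @N_ K n.
Proof.
apply/seteqP; split=> x.
  move=> [Ux [kappa [k0 _ cE _]]]; apply/N_gapP; split=> //; exists kappa => //.
  by move=> k kn; apply: cE => //; lia.
move=> /N_gapP[Ux [kappa k0 cE]]; split=> //; exists kappa; split=> //; try lia.
by move=> k kn _; apply: cE.
Qed.

Section BasePoint.
Variables (x0 : affine K (n + n.-1)) (kappa0 : K).
Hypotheses (Ux0 : U x0) (kappa0_neq0 : kappa0 != 0).
Hypothesis cx0 : forall k, (0 < k <= n.-1)%N -> c_ x0 k = kappa0 * gap x0 k.
Local Notation flag := (flag x0 kappa0).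

Lemma flag_base s : flag s x0.
Proof. by split=> //; exists kappa0; split=> // k kn _; apply: cx0. Qed.

(** Two points are joined by interpolating the [a_i], [kappa] and the free [c_k],
    while the other [c_k] are given by their defining formula. *)
Lemma flag_irreducible s : irreducible (flag s).
Proof.
apply: irreducible_curves; first by exists x0; exact: flag_base.
move=> x y [Ux [kx [kx0 kxE cxE axE]]] [Uy [ky [ky0 kyE cyE ayE]]].
pose a k := lerp (a_ x k) (a_ y k).
pose c k := if (k + s <= n.*2)%N then
    lerp kx ky * ((a k.+1 - a 1) * (a k - a n)) else lerp (c_ x k) (c_ y k).
have gap_at t k : (0 < k <= n.-1)%N ->
    gap (curve_at (glue n a c) t) k = ((a k.+1 - a 1) * (a k - a n)).[t].
  by move=> kn; rewrite curve_glue /gap !a_point ?(hornerM, hornerD, hornerN) //; lia.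
exists (glue n a c), (lerp kx ky * pullback (glue n a c) (discr K n)).
have at0 : curve_at (glue n a c) 0 = x.
  rewrite curve_glue; apply: affine_ext => k kn.
    by rewrite a_point // /a lerp0.
  rewrite c_point // /c; case: ifP => ks; last by rewrite lerp0.
  by rewrite /a !(lerp0, hornerM, hornerD, hornerN) cxE.
have at1 : curve_at (glue n a c) 1 = y.
  rewrite curve_glue; apply: affine_ext => k kn.
    by rewrite a_point // /a lerp1.
  rewrite c_point // /c; case: ifP => ks; last by rewrite lerp1.
  by rewrite /a !(lerp1, hornerM, hornerD, hornerN) cyE.
split=> //.
  apply: mulf_neq0; first by apply: contraNneq kx0 => l0; rewrite -(lerp0 kx ky) l0 horner0.
  move/principal_stratumE: Ux; apply: contraNneq => d0.
  by rewrite -at0 -horner_pullback d0 horner0.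
move=> t; rewrite hornerM mulf_eq0 negb_or horner_pullback => /andP[kt dt].
split; first exact/principal_stratumE.
exists (lerp kx ky).[t]; split=> //.
- by move=> sn; rewrite (kxE sn) (kyE sn) lerp_id.
- move=> k kn ks; rewrite gap_at // curve_glue c_point // /c ks.
  by rewrite hornerM.
move=> i si; rewrite curve_glue a_point; last lia.
by rewrite /a axE // ayE // lerp_id.
Qed.

Lemma flag_proper s : (s.+1 < n.*2)%N -> exists2 y, flag s.+1 y & ~ flag s y.
Proof.
move=> s2n; have n1 : (0 < 1 <= n.-1)%N by lia.
have ax0 i j : (0 < i <= n)%N -> (0 < j <= n)%N -> a_ x0 i = a_ x0 j -> i = j.
  by move=> ni nj; apply: contraPP; case: Ux0 => + _; apply.
have [sn|ns|sn] := ltngtP s n.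
(* the coordinate a_(s+1) moves *)
- have [z zP] := exists_notin [seq a_ x0 i | i <- iota 0 n.+1].
  have zx0 i : (0 < i <= n)%N -> z <> a_ x0 i.
    move=> ni zi; move/negP: zP; apply; apply/mapP; exists i => //.
    by rewrite mem_iota; lia.
  pose a i := if i == s.+1 then z else a_ x0 i.
  pose g k := (a k.+1 - a 1) * (a k - a n).
  have ainj i j : (0 < i <= n)%N -> (0 < j <= n)%N -> a i = a j -> i = j.
    move=> ni nj; rewrite /a; case: eqP => [->|_]; case: eqP => [->|_] //.
    - by move/(zx0 j nj).
    - by move/esym/(zx0 i ni).
    by apply: ax0.
  have g0 k : (0 < k <= n.-1)%N -> kappa0 * g k != 0.
    move=> kn; rewrite !mulf_neq0 // subr_eq0; apply/eqP => /ainj; lia.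
  have gE k : (0 < k <= n.-1)%N -> gap (point n a (fun k => kappa0 * g k)) k = g k.
    by move=> kn; rewrite /gap !a_point //; lia.
  exists (point n a (fun k => kappa0 * g k)).
    split; first exact: point_stratum.
    exists kappa0; split=> // [k kn _|i si]; first by rewrite c_point // gE.
    by rewrite a_point /a; [case: eqP => //; lia|lia].
  move=> [_ [kappa [_ _ _ /(_ s.+1)]]]; rewrite a_point ?ltnSn //= /a eqxx.
  by move=> /(_ sn); apply: zx0.
(* the coordinate c_(2n-s) leaves the graph *)
- pose k0 := (n.*2 - s)%N.
  have k0n : (0 < k0 <= n.-1)%N by rewrite /k0; lia.
  have [z] := exists_notin [:: 0; kappa0 * gap x0 k0].
  rewrite !inE negb_or => /andP[z0 zk].
  pose y := point n (a_ x0) (fun k => if k == k0 then z else kappa0 * gap x0 k).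
  have gE k : (0 < k <= n.-1)%N -> gap y k = gap x0 k.
    by move=> kn; rewrite /gap !a_point //; lia.
  have cE k : (0 < k <= n.-1)%N ->
      c_ y k = if k == k0 then z else kappa0 * gap x0 k.
    by move=> kn; rewrite c_point.
  exists y.
    split.
      apply: point_stratum => // k kn; case: (k =P k0) => // _.
      by rewrite mulf_neq0 ?gap_neq0.
    exists kappa0; split=> // [k kn ks|i]; last lia.
    rewrite cE // gE //; case: eqP => // ke; by move: ks ns; rewrite ke /k0; lia.
  move=> [_ [kappa [_ _ ck _]]].
  have := ck 1%N n1; rewrite cE // gE // eqn_leq [(k0 <= 1)%N]leqNgt.
  have -> : (1 < k0)%N by rewrite /k0; lia.
  rewrite andbF => /(_ ltac:(lia))/(mulIf (gap_neq0 Ux0 n1)) kE.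
  have := ck k0 k0n; rewrite cE // gE // eqxx -kE => zE.
  by move/eqP: zk; apply; apply: zE; rewrite /k0; lia.
(* kappa moves *)
have [z] := exists_notin [:: 0; kappa0].
rewrite !inE negb_or => /andP[z0 zk].
pose y := point n (a_ x0) (fun k => z * gap x0 k).
have gE k : (0 < k <= n.-1)%N -> gap y k = gap x0 k.
  by move=> kn; rewrite /gap !a_point //; lia.
exists y.
  split; first by apply: point_stratum => // k kn; rewrite mulf_neq0 ?gap_neq0.
  exists z; split=> // [|k kn ks|i si]; try lia.
  by rewrite c_point // gE.
move=> [_ [kappa [_ /(_ ltac:(lia)) -> ck _]]].
have := ck 1%N n1; rewrite c_point // gE // => /(_ ltac:(lia)).
by move/(mulIf (gap_neq0 Ux0 n1))/eqP; apply/negP.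
Qed.

Lemma flag_separated s : (s.+1 < n.*2)%N -> separated (flag s) (flag s.+1).
Proof.
move=> s2n; split; [exact: flag_sub | exact: flag_irreducible |].
exists (zero_locus (flag_eqs x0 kappa0 s)); first exact: zero_locus_closed.
rewrite flag_closed //; split=> [x []//|sub].
have [y Fy] := flag_proper s2n; rewrite flag_closed //; apply.
by split; [case: Fy | apply/sub/Fy].
Qed.

End BasePoint.
End Flag.

(** * Dimension and codimension of N *)

Section Dimension.
Local Open Scope ring_scope.
Variables (K : closedFieldType) (n : nat).
Hypothesis n_ge3 : (3 <= n)%N.
Local Notation U := (@principal_stratum K n).
Local Notation N := (@N_ K n).

Lemma separated_sub m (Z1 Z2 Z3 : set (affine K m)) :
  Z1 `<=` Z2 -> separated Z2 Z3 -> separated Z1 Z3.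
Proof.
move=> Z12 [Z23 irr [F Fc [ZF nF]]]; split=> //; first exact: subset_trans Z23.
by exists F => //; split=> //; apply: subset_trans ZF.
Qed.

Lemma chain_separated m (X : set (affine K m)) Zs l i :
  irreducible_chain X Zs l -> (i < l)%N -> separated (Zs i) (Zs i.+1).
Proof.
move=> [irrZ ltZ] il; have [[F Fc ZF] irrZi] := irrZ i (ltnW il).
have [[F' _ ZF'] irrZS] := irrZ i.+1 il; have [ZZ nZZ] := ltZ i il.
split=> //; exists F => //; split; first by rewrite ZF; apply: subIsetr.
move=> ZSF; apply: nZZ => y Zy; rewrite ZF; split; last exact: ZSF.
by move: Zy; rewrite ZF' => -[].
Qed.

Lemma chain_nonempty m (X : set (affine K m)) Zs l :
  irreducible_chain X Zs l -> Zs 0%N !=set0.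
Proof. by move=> [/(_ 0%N (leq0n l))[_ []]]. Qed.

Lemma flag_closed_in (x0 : affine K (n + n.-1)) kappa0 X s : kappa0 != 0 ->
  X `<=` U -> flag x0 kappa0 s `<=` X -> closed_in X (flag x0 kappa0 s).
Proof.
move=> k0 XU fX; exists (zero_locus (flag_eqs x0 kappa0 s)).
  exact: zero_locus_closed.
apply/seteqP; split=> x.
  by move=> fx; split; [exact: fX | move: fx; rewrite flag_closed // => -[]].
by move=> [Xx eqs]; rewrite flag_closed //; split=> //; apply: XU.
Qed.

Lemma flag_chain x0 kappa0 X s l : U x0 -> kappa0 != 0 ->
  (forall k, (0 < k <= n.-1)%N -> c_ x0 k = kappa0 * gap x0 k) ->
  (s + l < n.*2)%N -> X `<=` U -> flag x0 kappa0 (s + l) `<=` X ->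
  irreducible_chain X (fun i => flag x0 kappa0 (s + i)) l.
Proof.
move=> Ux0 k0 cx0 sl XU fX; split=> i il.
  split; last exact: flag_irreducible.
  apply: flag_closed_in => //; apply: subset_trans fX; apply: flag_sub; lia.
rewrite addnS; split; first exact: flag_sub.
have [|y fy nfy] := @flag_proper K n n_ge3 x0 kappa0 Ux0 k0 (s + i); first lia.
by move=> /(_ y fy).
Qed.

Lemma N_sub_U : N `<=` U. Proof. by move=> x []. Qed.

(** A chain in [N] is continued by the [n - 2] terms of the flag above [N]. *)
Lemma N_chain_le Zs l : irreducible_chain N Zs l -> (l <= n.+1)%N.
Proof.
move=> chZ; have [[F _ ZF] [[x0 Zx0] _]] := chZ.1 l (leqnn l).
have ZN : Zs l `<=` N by rewrite ZF; apply: subIsetl.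
have [Ux0 [kappa0 k0 cx0]] := (N_gapP x0).1 (ZN _ Zx0).
have sepf s := @flag_separated K n n_ge3 x0 kappa0 Ux0 k0 cx0 s.
pose W i := if (i <= l)%N then Zs i else flag x0 kappa0 (n.+1 + (i - l)).
suff : (l + (n - 2) <= n + n.-1)%N by lia.
apply: (@chain_length_le K _ W); first by rewrite /W leq0n; exact: chain_nonempty chZ.
move=> i il; rewrite /W; have [lti|lei] := ltnP i l.
  by rewrite ltnW //; exact: chain_separated chZ _.
have [ei|nei] := eqVneq i l.
  rewrite ei leqnn subSnn addn1; apply: separated_sub (sepf n.+1 _); last lia.
  by rewrite flag_N.
rewrite leqNgt ltn_neqAle lei eq_sym nei /= subSn // addnS.
apply: sepf; lia.
Qed.

Lemma N_has_dim_at x0 : N x0 -> has_dim_at N x0 n.+1.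
Proof.
move=> /N_gapP[Ux0 [kappa0 k0 cx0]]; split; last by move=> Zs l [/N_chain_le].
exists (fun i => flag x0 kappa0 (0 + i)); split; last first.
  by move=> i _; apply: flag_base.
apply: flag_chain => //; [lia | exact: N_sub_U | by rewrite add0n flag_N].
Qed.

Lemma exists_injective_seq m : exists a : nat -> K,
  forall i j, (i < m)%N -> (j < m)%N -> a i = a j -> i = j.
Proof.
elim: m => [|m [a ainj]]; first by exists (fun=> 0).
have [z zP] := exists_notin [seq a i | i <- iota 0 m].
have za i : (i < m)%N -> a i <> z.
  by move=> im az; move/negP: zP; apply; rewrite -az map_f // mem_iota.
exists (fun i => if (i < m)%N then a i else z) => i j im jm.
case: ltnP => mi; case: ltnP => mj; [exact: ainj | by move/za: mi | | lia].
by move/esym; move/za: mj.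
Qed.

Lemma N_nonempty : N !=set0.
Proof.
have [a ainj] := exists_injective_seq n.+1.
have ainj' i j : (0 < i <= n)%N -> (0 < j <= n)%N -> a i = a j -> i = j.
  by move=> ni nj; apply: ainj; lia.
pose g k := (a k.+1 - a 1%N) * (a k - a n).
exists (point n a g); apply/N_gapP; split.
  apply: point_stratum => // k kn.
  by rewrite mulf_neq0 // subr_eq0; apply/eqP => /ainj'; lia.
exists 1; rewrite ?oner_neq0 // => k kn.
by rewrite c_point // mul1r /gap !a_point //; lia.
Qed.

Lemma N_has_dim : has_dim N n.+1.
Proof.
have [x0 /N_has_dim_at[[Zs [chZ _]] _]] := N_nonempty.
by split; [exists Zs | exact: N_chain_le].
Qed.

Lemma N_irreducible : irreducible N.
Proof.
have [x0 /N_gapP[Ux0 [kappa0 k0 cx0]]] := N_nonempty.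
by rewrite -(flag_N n_ge3 x0 kappa0); apply: flag_irreducible.
Qed.

Lemma N_closed_in_U : closed_in U N.
Proof.
have [x0 /N_gapP[Ux0 [kappa0 k0 cx0]]] := N_nonempty.
rewrite -(flag_N n_ge3 x0 kappa0); apply: flag_closed_in => // x; by case.
Qed.

Lemma closure_closed_in (T : topologicalType) (X Z : set T) :
  closed_in X Z -> X `&` closure Z = Z.
Proof.
move=> [F Fc ZF]; apply/seteqP; split=> x.
  move=> [Xx clx]; rewrite ZF; split=> //; rewrite ((closure_id F).1 Fc).
  by apply: closure_subset clx; rewrite ZF; apply: subIsetr.
by move=> Zx; split; [move: Zx; rewrite ZF => -[] | exact: subset_closure].
Qed.

(** The closed subset [N] of [U] is its own closure in [U]; a chain that starts
    with [N] is preceded by the [n + 1] terms of the flag below [N]. *)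
Lemma N_has_codim : has_codim U N (n - 2).
Proof.
have UN := closure_closed_in N_closed_in_U.
have [x0 /N_gapP[Ux0 [kappa0 k0 cx0]]] := N_nonempty.
have sepf s := @flag_separated K n n_ge3 x0 kappa0 Ux0 k0 cx0 s.
rewrite /has_codim UN; split.
  exists (fun i => flag x0 kappa0 (n.+1 + i)); split; last by rewrite addn0 flag_N.
  apply: flag_chain => //; first lia.
  by move=> x [].
move=> Zs l [chZ Z0].
pose W i := if (i <= n)%N then flag x0 kappa0 i else Zs (i - n.+1)%N.
suff : (n.+1 + l <= n + n.-1)%N by lia.
apply: (@chain_length_le K _ W); first by exists x0; rewrite /W leq0n; exact: flag_base.
move=> i il; rewrite /W; have [lti|gti|->] := ltngtP i n.
- by apply: sepf; lia.
- rewrite subSn //.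
  by apply: chain_separated chZ _; lia.
by rewrite subnn Z0 -(flag_N n_ge3 x0 kappa0); apply: sepf; lia.
Qed.

End Dimension.

(** * The quadratic factor *)

Section Factor.
Local Open Scope ring_scope.
Variables (K : closedFieldType) (n : nat).
Hypothesis n_ge2 : (2 <= n)%N.
Implicit Types (x : affine K (n + n.-1)).

Local Notation cst z := ((z%:P : {poly K})%:P : {poly {poly K}}).

(** [(lambda + a_1) (lambda + a_n) + kappa t (a_1 - a_n)^2]; the outer variable is
    [lambda], the inner one [t]. *)
Definition quadratic_factor x (kappa : K) : {poly {poly K}} :=
  ('X + cst (a_ x 1)) * ('X + cst (a_ x n)) +
  ('X * kappa%:P * ((a_ x 1 - a_ x n) ^+ 2)%:P)%:P.

Lemma quadratic_factor_dvd x kappa :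
  (forall k, (0 < k <= n.-1)%N -> c_ x k = kappa * gap x k) ->
  exists G, P_ x n = quadratic_factor x kappa * G.
Proof.
move=> cE; pose A k : {poly {poly K}} := 'X + cst (a_ x k).
pose u := A 1%N; pose w := A n; pose tau : {poly {poly K}} := ('X)%:P * cst kappa.
pose F := quadratic_factor x kappa.
have FE : F = u * w + tau * (u - w) ^+ 2.
  rewrite /F /quadratic_factor -/(A 1%N) -/(A n) -/u -/w; congr (_ + _).
  have -> : u - w = cst (a_ x 1 - a_ x n) by rewrite /u /w /A !polyCB; ring.
  by rewrite /tau !polyC_exp !polyCM; ring.
have rec k : (k.+2 <= n)%N ->
    P_ x k.+2 = A k.+2 * P_ x k.+1 - tau * (A k.+2 - u) * (A k.+1 - w) * P_ x k.
  move=> kn; have -> : P_ x k.+2 =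
      A k.+2 * P_ x k.+1 - ('X)%:P * cst (c_ x k.+1) * P_ x k by [].
  rewrite cE; last lia.
  have -> : A k.+2 - u = cst (a_ x k.+2 - a_ x 1) by rewrite /u /A !polyCB; ring.
  have -> : A k.+1 - w = cst (a_ x k.+1 - a_ x n) by rewrite /w /A !polyCB; ring.
  by rewrite /tau /gap !polyCM; ring.
(* the index is shifted: Q k belongs to P_(k+1) *)
pose Q k := P_ x k.+1 - tau * (A k.+1 - w) * P_ x k.
have step k : (k.+2 <= n)%N -> P_ x k.+2 = u * P_ x k.+1 + (A k.+2 - u) * Q k.
  by move=> kn; rewrite rec // /Q; ring.
have stepQ k : (k.+2 <= n)%N -> Q k.+1 =
    (u - tau * (u - w)) * P_ x k.+1 + (A k.+2 - u) * (Q k - tau * P_ x k.+1).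
  by move=> kn; rewrite [in LHS]/Q step //; ring.
have dvd k : (k < n)%N -> exists S R,
    u * P_ x k.+1 - (u - w) * Q k = F * S /\
    w * Q k + (u - w) * tau * P_ x k.+1 = F * R.
  elim: k => [|k IH] kn.
    by exists 1, 1; rewrite FE /Q /= -/(A 1%N) -/u; split; ring.
  have [S [R [SE RE]]] := IH (ltnW kn).
  exists (P_ x k.+1 + (A k.+2 - u) * R).
  exists (P_ x k.+1 + (A k.+2 - u) * (R - tau * S)).
  have -> : F * (P_ x k.+1 + (A k.+2 - u) * R) =
    F * P_ x k.+1 + (A k.+2 - u) * (F * R) by ring.
  have -> : F * (P_ x k.+1 + (A k.+2 - u) * (R - tau * S)) =
    F * P_ x k.+1 + (A k.+2 - u) * (F * R - tau * (F * S)) by ring.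
  by rewrite -SE -RE FE stepQ // step //; split; ring.
(* for the last step A_n - u = w - u, so that P_n = u P_(n-1) - (u - w) Q_(n-1) *)
have [S [R [SE _]]] := dvd n.-2 ltac:(lia).
exists S; rewrite -/F -SE.
have nE : n = n.-2.+2 by lia.
have Aw : A n.-2.+2 = w by congr (A _).
transitivity (P_ x n.-2.+2); first by congr (P_ x _).
rewrite step; last by rewrite -nE.
by rewrite Aw; ring.
Qed.

Lemma quadratic_factor_monic x kappa : quadratic_factor x kappa \is monic.
Proof.
have monM : ('X + cst (a_ x 1)) * ('X + cst (a_ x n)) \is monic.
  by rewrite monicMl ?monicXaddC.
rewrite /quadratic_factor monicE lead_coefDl ?(eqP monM) //.
apply: leq_ltn_trans (size_polyC_leq1 _) _.
by rewrite size_monicM ?monicXaddC ?monic_neq0 ?monicXaddC // !size_XaddC.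
Qed.

Lemma quadratic_factor_t0 x kappa : at_t0 (quadratic_factor x kappa) =
  ('X + (a_ x 1)%:P) * ('X + (a_ x n)%:P).
Proof.
rewrite /at_t0 /quadratic_factor rmorphD rmorphM !rmorphD /= !map_polyX !map_polyC /=.
by rewrite /horner_eval !hornerE.
Qed.

Lemma prod_first_last x : \prod_(i in first_last n) ('X + (a_ x i.+1)%:P) =
  ('X + (a_ x 1)%:P) * ('X + (a_ x n)%:P).
Proof.
have n0 : (0 < n)%N by lia.
have n1 : (n.-1 < n)%N by lia.
have -> : first_last n = [set Ordinal n0; Ordinal n1]%SET.
  by apply/setP => i; rewrite !inE -!val_eqE /=; lia.
rewrite big_setU1 ?big_set1 /=; first by rewrite prednK.
by rewrite !inE -val_eqE /=; lia.
Qed.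

Lemma N_sub_reducible : @N_ K n `<=` @reducible_stratum K n (first_last n).
Proof.
move=> x /N_gapP[Ux [kappa _ cE]]; split=> //.
exists (quadratic_factor x kappa); split.
- exact: quadratic_factor_dvd.
- exact: quadratic_factor_monic.
by rewrite quadratic_factor_t0 prod_first_last.
Qed.

End Factor.

(** * The tangent space of N *)

Section TangentSpace.
Local Open Scope ring_scope.
Variables (K : closedFieldType) (n : nat).
Hypothesis n_ge3 : (3 <= n)%N.
Implicit Types (x v : affine K (n + n.-1)).
Local Notation N := (@N_ K n).

(** The derivative of [gap] at [x] in the direction [v]; tangent vectors are
    read through the same accessors as points. *)
Definition dgap x v k := (a_ v k.+1 - a_ v 1) * (a_ x k - a_ x n) +
  (a_ x k.+1 - a_ x 1) * (a_ v k - a_ v n).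

Lemma pullback_mA (a c : nat -> {poly K}) k : (0 < k <= n)%N ->
  pullback (glue n a c) (mA k) = a k.
Proof.
case: k => // k kn; rewrite /mA /= insubT /= pullbackX.
by rewrite glue_l.
Qed.

Lemma pullback_mC (a c : nat -> {poly K}) k : (0 < k <= n.-1)%N ->
  pullback (glue n a c) (mC k) = c k.
Proof.
case: k => // k kn; rewrite /mC /= insubT /= pullbackX.
by rewrite glue_r.
Qed.

Lemma glue_deriv (a c : nat -> {poly K}) v t i :
  (forall k, (0 < k <= n)%N -> ((a k)^`()).[t] = a_ v k) ->
  (forall k, (0 < k <= n.-1)%N -> ((c k)^`()).[t] = c_ v k) ->
  ((glue n a c i)^`()).[t] = (v : 'rV[K]_(n + n.-1)) ord0 i.
Proof.
move=> av cv; rewrite -[RHS]/(coord v i) -(splitK i).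
case: (split i) => j /=; rewrite ?glue_l ?glue_r -?a_E -?c_E.
  by apply: av; rewrite ltn_ord.
by apply: cv; rewrite ltn_ord.
Qed.

Section AtPoint.
Variables (x : affine K (n + n.-1)) (kappa : K).
Hypotheses (Ux : principal_stratum x) (kappa_neq0 : kappa != 0).
Hypothesis cx : forall k, (0 < k <= n.-1)%N -> c_ x k = kappa * gap x k.

(** The differentials at [x] of the equations [c_k gap_1 = c_1 gap_k] of [N]. *)
Lemma tangent_equation v k : (0 < k <= n.-1)%N ->
  dir_deriv (mC k * mgap 1 - mC 1 * mgap k) x v =
  c_ v k * gap x 1 + c_ x k * dgap x v 1 - c_ v 1 * gap x k - c_ x 1 * dgap x v k.
Proof.
move=> kn; pose a i := (a_ x i)%:P + (a_ v i)%:P * 'X.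
pose c i := (c_ x i)%:P + (c_ v i)%:P * 'X.
have a0 i : (a i).[0] = a_ x i by rewrite /a !hornerE.
have c0 i : (c i).[0] = c_ x i by rewrite /c !hornerE.
have da i : (a i)^`() = (a_ v i)%:P.
  by rewrite /a derivD derivC add0r derivM derivC derivX mul0r add0r mulr1.
have dc i : (c i)^`() = (c_ v i)%:P.
  by rewrite /c derivD derivC add0r derivM derivC derivX mul0r add0r mulr1.
have xE : x = curve_at (glue n a c) 0.
  by rewrite curve_glue; apply: affine_ext => i ni; rewrite ?a_point ?c_point ?a0 ?c0.
rewrite [in LHS]xE (@dir_deriv_curve _ _ (glue n a c) _ 0 v); last first.
  by move=> i; apply: glue_deriv => j nj; rewrite ?da ?dc hornerC.
rewrite /mgap rmorphB !rmorphM !rmorphB /= !pullback_mA ?pullback_mC; try lia.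
rewrite derivB !derivM !derivB !da !dc !(a0, c0, hornerM, hornerD, hornerN, hornerC).
by rewrite /gap /dgap; ring.
Qed.

(** Along the curve in [N] obtained by moving [a] linearly with velocity [v] and
    [kappa] with velocity [beta], a polynomial vanishing on [N] is zero. *)
Lemma tangent_vector v beta :
  (forall k, (0 < k <= n.-1)%N -> c_ v k = beta * gap x k + kappa * dgap x v k) ->
  forall p, (forall y, N y -> peval p y = 0) -> dir_deriv p x v = 0.
Proof.
move=> cv p pN; pose a i := (a_ x i)%:P + (a_ v i)%:P * 'X.
pose kt := kappa%:P + beta%:P * 'X.
pose g k := (a k.+1 - a 1%N) * (a k - a n).
pose c k := kt * g k.
have a0 i : (a i).[0] = a_ x i by rewrite /a !hornerE.
have kt0 : kt.[0] = kappa by rewrite /kt !hornerE.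
have da i : (a i)^`() = (a_ v i)%:P.
  by rewrite /a derivD derivC add0r derivM derivC derivX mul0r add0r mulr1.
have dk : kt^`() = beta%:P.
  by rewrite /kt derivD derivC add0r derivM derivC derivX mul0r add0r mulr1.
have g0 k : (g k).[0] = gap x k.
  by rewrite /g !(a0, hornerM, hornerD, hornerN).
have dg k : ((g k)^`()).[0] = dgap x v k.
  rewrite /g derivM !derivB !da !(a0, hornerM, hornerD, hornerN, hornerC).
  by rewrite /dgap; ring.
have xE : x = curve_at (glue n a c) 0.
  rewrite curve_glue; apply: affine_ext => i ni.
    by rewrite a_point ?a0.
  by rewrite c_point // /c hornerM kt0 g0 cx.
rewrite xE (@dir_deriv_curve _ _ (glue n a c) _ 0 v); last first.
  move=> i; apply: glue_deriv => j nj; first by rewrite da hornerC.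
  by rewrite /c derivM dk !(hornerC, g0, kt0, dg, hornerM, hornerD) cv.
suff -> : pullback (glue n a c) p = 0 by rewrite derivC horner0.
pose h := kt * pullback (glue n a c) (discr K n).
have h0 : h != 0.
  apply: mulf_neq0; first by apply: contraNneq kappa_neq0 => k0; rewrite -kt0 k0 horner0.
  move/principal_stratumE: Ux; apply: contraNneq => d0.
  by rewrite xE -horner_pullback d0 horner0.
apply: (mulfI h0); rewrite mulr0; apply: contrapT => /eqP/closed_nonrootP[t].
rewrite rootE !hornerM !mulf_eq0 !negb_or !horner_pullback -andbA.
move=> /and3P[kt_neq0 /principal_stratumE Ut].
rewrite pN ?eqxx //; apply/N_gapP; split=> //; exists kt.[t] => // k kn.
rewrite curve_glue c_point // /c hornerM /gap !a_point; try lia.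
by rewrite /g !(hornerM, hornerD, hornerN).
Qed.

(** The differential at [(a, kappa)] of the parametrization
    [(a, kappa) |-> (a, kappa gap(a))]; the last entry of [w] is the component
    along [kappa]. *)
Definition tangent_param (w : 'rV[K]_n.+1) : affine K (n + n.-1) :=
  let a k := w ord0 (inord k.-1) in
  point n a (fun k => w ord0 ord_max * gap x k +
    kappa * ((a k.+1 - a 1%N) * (a_ x k - a_ x n) +
             (a_ x k.+1 - a_ x 1) * (a k - a n))).

(** The same map between spaces of row vectors, where it is linear. *)
Definition tangent_mx : 'rV[K]_n.+1 -> 'rV[K]_(n + n.-1) := tangent_param.

Lemma tangent_mx_linear : linear tangent_mx.
Proof.
move=> l w1 w2; apply/rowP => i; rewrite !mxE /glue.
by case: (split i) => j; rewrite !mxE //; ring.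
Qed.

HB.instance Definition _ := GRing.isLinear.Build K 'rV[K]_n.+1
  'rV[K]_(n + n.-1) *:%R tangent_mx tangent_mx_linear.

Lemma a_tangent w k : (0 < k <= n)%N ->
  a_ (tangent_mx w : affine K (n + n.-1)) k = w ord0 (inord k.-1).
Proof. by move=> kn; rewrite a_point. Qed.

Lemma c_tangent w k : (0 < k <= n.-1)%N ->
  c_ (tangent_mx w : affine K (n + n.-1)) k =
  w ord0 ord_max * gap x k + kappa * dgap x (tangent_mx w) k.
Proof. by move=> kn; rewrite c_point // /dgap !a_tangent //; lia. Qed.

Lemma N_tangent_space : exists V : {vspace 'rV[K]_(n + n.-1)},
  is_tangent_space N x V /\ \dim V = n.+1.
Proof.
have n1 : (0 < 1 <= n.-1)%N by lia.
have g1 := gap_neq0 Ux n1.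
have row_ord (w : 'rV[K]_n.+1) (i : 'I_n.+1) : (i < n)%N ->
    w ord0 i = a_ (tangent_mx w : affine K (n + n.-1)) i.+1.
  by move=> iltn; rewrite a_tangent //= inord_val.
exists (limg (linfun tangent_mx)); split; last first.
  rewrite limg_dim_eq; first by rewrite dimvf /dim /= mul1n.
  apply/eqP; rewrite -subv0; apply/subvP => w.
  rewrite memv_cap memvf memv_ker lfunE /= memv0 => /eqP w0.
  have wa k : a_ (tangent_mx w : affine K (n + n.-1)) k = 0.
    by rewrite w0 /a_; case: insub => //= i; rewrite /coord mxE.
  apply/eqP/rowP => i; rewrite mxE; have [iltn|] := ltnP i n.
    by rewrite row_ord.
  move=> ni; have -> : i = ord_max by apply: val_inj => /=; have := ltn_ord i; lia.
  have := c_tangent w n1; rewrite /dgap !wa !subr0 mul0r mulr0 addr0 mulr0 addr0.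
  have -> : c_ (tangent_mx w : affine K (n + n.-1)) 1 = 0.
    by rewrite w0 /c_; case: insub => //= j; rewrite /coord mxE.
  by move/esym/eqP; rewrite mulf_eq0 (negbTE g1) orbF => /eqP.
move=> v; split.
  move=> /memv_imgP[w _ ->] p pN; rewrite lfunE /=.
  exact: (tangent_vector (c_tangent w) pN).
(* beta is the velocity of kappa = c_1 / gap_1 *)
move=> tv; pose beta := (c_ (v : affine K _) 1 - kappa * dgap x v 1) / gap x 1.
pose w : 'rV[K]_n.+1 := \row_(i < n.+1)
  if (i < n)%N then a_ (v : affine K _) i.+1 else beta.
suff -> : v = linfun tangent_mx w by rewrite memv_img ?memvf.
rewrite lfunE /=.
have wa k : (0 < k <= n)%N -> a_ (tangent_mx w : affine K (n + n.-1)) k =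
    a_ (v : affine K _) k.
  move=> kn; rewrite a_tangent // mxE inordK; last lia.
  by case: k kn => //= k ->.
have wb : w ord0 ord_max = beta by rewrite mxE /= ltnn.
apply: affine_ext => k kn; first by rewrite wa.
rewrite c_tangent // wb.
have -> : dgap x (tangent_mx w) k = dgap x v k.
  by rewrite /dgap !wa //; lia.
have := tv (mC k * mgap 1 - mC 1 * mgap k); rewrite -/(dir_deriv _ x v).
rewrite tangent_equation // !cx // => /(_ _)/eqP.
have eqN y : N y -> peval (mC k * mgap 1 - mC 1 * mgap k) y = 0.
  by move=> /N_gapP[_ [l _ cy]]; rewrite !strataE !cy //; ring.
move=> /(_ eqN)/eqP eqv; apply: (mulIf g1).
have bE : beta * gap x 1 = c_ (v : affine K _) 1 - kappa * dgap x v 1.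
  by rewrite /beta mulfVK.
rewrite mulrDl mulrAC bE; apply/eqP; rewrite -subr_eq0 -[X in _ == X]eqv; apply/eqP.
by ring.
Qed.

End AtPoint.

Lemma N_smooth : smooth N.
Proof.
move=> x Nx; have [Ux [kappa k0 cx]] := (N_gapP x).1 Nx.
have [V [tV dV]] := N_tangent_space Ux k0 cx.
exists V, n.+1; split=> //; exact: N_has_dim_at.
Qed.

End TangentSpace.

(** * The isomorphism with an open set *)

Section Chart.
Local Open Scope ring_scope.
Variables (K : closedFieldType) (n : nat).
Hypothesis n_ge3 : (3 <= n)%N.
Local Notation U := (@principal_stratum K n).
Local Notation N := (@N_ K n).

(** [(a, c) |-> (a, kappa)], where [kappa = c_1 / gap_1] is the last coordinate. *)
Definition chart (x : affine K (n + n.-1)) : affine K n.+1 :=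
  \row_(i < n.+1) if (i < n)%N then a_ x i.+1 else c_ x 1 / gap x 1.

(** The coordinates of the inverse map [(a, kappa) |-> (a, kappa gap(a))]. *)
Definition param_poly : 'I_(n + n.-1) -> {mpoly K[n.+1]} :=
  let a k := 'X_(inord k.-1) in
  glue n a (fun k => 'X_ord_max * ((a k.+1 - a 1%N) * (a k - a n))).

Definition param (y : affine K n.+1) : affine K (n + n.-1) :=
  \row_i peval (param_poly i) y.

Lemma a_param y k : (0 < k <= n)%N -> a_ (param y) k = coord y (inord k.-1).
Proof.
move=> /(a_ord (param y))[i -> ->].
by rewrite coord_row /param_poly glue_l pevalU.
Qed.

Lemma c_param y k : (0 < k <= n.-1)%N ->
  c_ (param y) k = coord y ord_max * gap (param y) k.
Proof.
move=> kn; rewrite /gap !a_param; try lia.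
have [i -> ->] := c_ord (param y) kn.
by rewrite coord_row /param_poly glue_r !pevalE.
Qed.

(** Since [c_1 <> 0] on [U], this set forces [kappa <> 0] as well. *)
Definition chart_domain : set (affine K n.+1) := [set y | U (param y)].

Lemma open_chart_domain : open chart_domain.
Proof.
pose q := discr K n \mPo [tuple param_poly i | i < n + n.-1].
suff -> : chart_domain = [set y | peval q y != 0] by exact: open_nonzero.
have qE y : peval q y = peval (discr K n) (param y).
  rewrite /peval comp_mpoly_meval; apply: meval_eq => i.
  by rewrite tnth_mktuple coord_row.
by apply/seteqP; split=> y /=; rewrite qE => /principal_stratumE.
Qed.

Lemma chartK x : N x -> param (chart x) = x.
Proof.
move=> /N_gapP[Ux [kappa k0 cE]]; have n1 : (0 < 1 <= n.-1)%N by lia.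
have aE k : (0 < k <= n)%N -> a_ (param (chart x)) k = a_ x k.
  move=> kn; rewrite a_param // coord_row inordK; last lia.
  by case: k kn => //= k ->.
apply: affine_ext => // k kn; rewrite c_param // coord_row /= ltnn.
have -> : gap (param (chart x)) k = gap x k by rewrite /gap !aE //; lia.
by rewrite !cE // mulfK // gap_neq0.
Qed.

Lemma paramK y : chart_domain y -> chart (param y) = y.
Proof.
move=> Uy; have n1 : (0 < 1 <= n.-1)%N by lia.
apply/rowP => i; rewrite mxE -[RHS]/(coord y i); case: ltnP => [iltn|ni].
  by rewrite a_param //= inord_val.
rewrite c_param // mulfK ?gap_neq0 //; congr coord.
by apply: val_inj => /=; have := ltn_ord i; lia.
Qed.

Lemma chart_morphism : morphism N chart_domain chart.
Proof.
split=> [x Nx|i x Nx]; first by rewrite /chart_domain /= chartK //; case: Nx.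
exists setT; have [iltn|ni] := ltnP i n.
  exists (mA i.+1), 1; split=> //; first exact: openT.
  move=> y _ _; rewrite /peval meval1 oner_eq0 -/(peval _ _) peval_mA divr1.
  by rewrite coord_row iltn.
exists (mC 1), (mgap 1); split=> //; first exact: openT.
move=> y [Uy _] _; rewrite !strataE gap_neq0 //; last lia.
by rewrite coord_row ltnNge ni.
Qed.

Lemma param_morphism : morphism chart_domain N param.
Proof.
split=> [y Uy|i y _].
  apply/N_gapP; split=> //; exists (coord y ord_max); last by move=> k; apply: c_param.
  have n1 : (0 < 1 <= n.-1)%N by lia.
  have := stratum_c Uy n1; rewrite c_param //.
  by apply: contraNneq => ->; rewrite mul0r.
exists setT, (param_poly i), 1; split=> //; first exact: openT.
by move=> z _ _; rewrite /peval meval1 oner_eq0 divr1 coord_row.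
Qed.

Lemma N_isomorphic : exists2 V : set (affine K n.+1), open V & isomorphic N V.
Proof.
exists chart_domain; first exact: open_chart_domain.
exists chart, param; split; [exact: chart_morphism | exact: param_morphism | |].
- exact: chartK.
exact: paramK.
Qed.

End Chart.

Theorem corollary6p3 (R : realType) (n : nat) (hn : (3 <= n)%N) :
  let C : closedFieldType := complex R in
  let N : set (affine C (n + n.-1)) := @N_ C n in
  let U : set (affine C (n + n.-1)) := @principal_stratum C n in
  [/\ N `<=` @reducible_stratum C n (first_last n),
      [/\ N `<=` U, locally_closed_in U N, irreducible N & smooth N],
      exists2 V : set (affine C n.+1), open V & isomorphic N V,
      has_dim N n.+1 &
      has_codim U N (n - 2) /\ (n - 2)%N = kappa_codim n 2].
Proof.
move=> C N U; split.
- by apply: N_sub_reducible; apply: ltnW.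
- split; [exact: N_sub_U | | exact: N_irreducible | exact: N_smooth].
  have [F Fc NF] := N_closed_in_U C hn.
  by exists setT, F; split=> //; [exact: openT | rewrite setTI].
- exact: N_isomorphic.
- exact: N_has_dim.
split; first exact: N_has_codim.
by rewrite /kappa_codim mul2n uphalf_double.
Qed.
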